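(* Let $p$ be an odd prime, $m$ an even positive integer, $\mathbb{M}=\mathbb{F}_{p^m}$, $\mathbb{L}=\mathbb{F}_{p^{m/2}}$, $1\le k\le m-1$ with $m/\gcd(k,m)$ odd, $q=p^k$, $r=p^{k+m/2}$, $e=\gcd(k,m)$ and $d=\gcd(k+m/2,m)$ (so that $e=2d$). Let $B\in\mathbb{M}^\times$ be a non-square, $a\in\mathbb{L}^\times$, and let $\mathbb{P}=(\mathbb{M}\times\mathbb{M},+,\ast)$ be the pre-semifield of Family $\mathcal{S}$ with multiplication $$(x,y)\ast(u,v)=\bigl(x^qu+xu^q+B(y^qv+yv^q),\ x^{r}v+yu^{r}+\tfrac aB(xv^{r}+y^{r}u)\bigr).$$ Then the left, middle and right nuclei of $\mathbb{P}$ satisfy $\mathbb{N}_l(\mathbb{P})=\mathbb{N}_r(\mathbb{P})\cong\mathbb{D}$ and $\mathbb{N}_m(\mathbb{P})\cong\mathbb{E}$, where $\mathbb{D}=\mathbb{F}_{p^d}$ and $\mathbb{E}=\mathbb{F}_{p^e}$.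
   Context: A pre-semifield is a finite additive group with a left and right distributive multiplication without zero divisors; a semifield has in addition a two-sided multiplicative identity. For a semifield $\mathbb{S}=(S,+,\circ)$ the nuclei are $\mathbb{N}_l(\mathbb{S})=\{x:(x\circ y)\circ z=x\circ(y\circ z)\ \forall y,z\in S\}$, $\mathbb{N}_m(\mathbb{S})=\{y:(x\circ y)\circ z=x\circ(y\circ z)\ \forall x,z\in S\}$, $\mathbb{N}_r(\mathbb{S})=\{z:(x\circ y)\circ z=x\circ(y\circ z)\ \forall x,y\in S\}$; they are finite fields and, up to isomorphism, isotopy invariants. (Isotopy of $(V,+,\circ_1)$ and $(V,+,\circ_2)$: existence of $\mathbb{F}_p$-linear bijections $N,L,M$ with $N(x\circ_1y)=L(x)\circ_2M(y)$.) The nuclei of a pre-semifield $\mathbb{P}$ with multiplication $\ast$ are by definition those of an isotopic semifield; since $\mathbb{P}$ is commutative one takes the commutative semifield given by Kaplansky's trick, $(x\ast\epsilon)\circ(\epsilon\ast y)=x\ast y$ for a fixed nonzero $\epsilon$. *)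

(* Defs.v *)
From HB Require Import structures.
From mathcomp Require Import all_boot all_order all_algebra.

Set Implicit Arguments.
Unset Strict Implicit.
Unset Printing Implicit Defensive.

Import GRing.Theory.
Local Open Scope ring_scope.

(* Derives the finZmodType structure of a product of two finZmodTypes, which
   the library leaves undeclared. *)
HB.saturate prod.

Definition presemifield (V : finZmodType) (mul : V -> V -> V) : Prop :=
  [/\ left_distributive mul +%R,
      right_distributive mul +%R &
      forall x y : V, mul x y = 0 -> x = 0 \/ y = 0].

Definition semifield (V : finZmodType) (mul : V -> V -> V) (one : V) : Prop :=
  [/\ presemifield mul, left_id one mul & right_id one mul].

Definition left_nucleus (V : finZmodType) (mul : V -> V -> V) : {set V} :=
  [set x | [forall y, forall z, mul (mul x y) z == mul x (mul y z)]].

Definition middle_nucleus (V : finZmodType) (mul : V -> V -> V) : {set V} :=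
  [set y | [forall x, forall z, mul (mul x y) z == mul x (mul y z)]].

Definition right_nucleus (V : finZmodType) (mul : V -> V -> V) : {set V} :=
  [set z | [forall x, forall y, mul (mul x y) z == mul x (mul y z)]].

(* A preimage of y under f; the default 0 is reached only when y is not a
   value of f. *)
Definition some_preimage (V : finZmodType) (f : V -> V) (y : V) : V :=
  odflt 0 [pick x | f x == y].

(* The product o determined by (x * eps) o (eps * y) = x * y. When * is a
   pre-semifield product and eps != 0, both x |-> x * eps and y |-> eps * y are
   bijections; see kaplanskyE and kaplansky_semifield. *)
Definition kaplansky (V : finZmodType) (mul : V -> V -> V) (eps : V) :
    V -> V -> V :=
  fun u v => mul (some_preimage (mul^~ eps) u) (some_preimage (mul eps) v).

(* The subset N of V, with the addition of V and the product mul, is a field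
   isomorphic to F. *)
Definition isomorphic_to_field (V : finZmodType) (mul : V -> V -> V)
    (N : {set V}) (F : finFieldType) : Prop :=
  exists f : F -> V,
    [/\ injective f,
        [set f x | x : F] = N,
        {morph f : x y / x + y >-> x + y} &
        {morph f : x y / x * y >-> mul x y}].

Definition familyS_mul (M : finFieldType) (q r : nat) (B a : M)
    (s t : M * M) : M * M :=
  let: (x, y) := s in
  let: (u, v) := t in
  (x ^+ q * u + x * u ^+ q + B * (y ^+ q * v + y * v ^+ q),
   x ^+ r * v + y * u ^+ r + a / B * (x * v ^+ r + y ^+ r * u)).

Lemma some_preimageK (V : finZmodType) (f : V -> V) :
  injective f -> cancel f (some_preimage f).
Proof.
move=> injf x; rewrite /some_preimage; case: pickP => [z /eqP/injf //|/(_ x)].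
by rewrite eqxx.
Qed.

Section Kaplansky.
Variables (V : finZmodType) (mul : V -> V -> V) (eps : V).
Hypotheses (pmul : presemifield mul) (eps0 : eps != 0).

Lemma presemifield_mulIr : injective (mul^~ eps).
Proof.
case: pmul => mulDl _ mul0 x y /= exy; apply/eqP; rewrite -subr_eq0.
have: mul (x - y) eps = 0.
  by apply: (addIr (mul y eps)); rewrite -mulDl subrK add0r.
by case/mul0 => [->|e0]; [rewrite eqxx | by move: eps0; rewrite e0 eqxx].
Qed.

Lemma presemifield_mulrI : injective (mul eps).
Proof.
case: pmul => _ mulDr mul0 x y /= exy; apply/eqP; rewrite -subr_eq0.
have: mul eps (x - y) = 0.
  by apply: (addIr (mul eps y)); rewrite -mulDr subrK add0r.
by case/mul0 => [e0|->]; [by move: eps0; rewrite e0 eqxx | rewrite eqxx].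
Qed.

Lemma kaplanskyE x y :
  kaplansky mul eps (mul x eps) (mul eps y) = mul x y.
Proof.
rewrite /kaplansky (some_preimageK presemifield_mulrI).
by rewrite (some_preimageK presemifield_mulIr x).
Qed.

Lemma kaplansky_semifield : semifield (kaplansky mul eps) (mul eps eps).
Proof.
have [mulDl mulDr mul0] := pmul.
have [g gK Kg] := injF_bij presemifield_mulIr.
have [h hK Kh] := injF_bij presemifield_mulrI.
have kE u v : kaplansky mul eps u v = mul (g u) (h v).
  by rewrite -{1}(Kg u) -{1}(Kh v) kaplanskyE.
have gD u v : g (u + v) = g u + g v.
  by apply: presemifield_mulIr; rewrite /= mulDl !Kg.
have hD u v : h (u + v) = h u + h v.
  by apply: presemifield_mulrI; rewrite /= mulDr !Kh.
have g0 : g 0 = 0 by apply: (addIr (g 0)); rewrite -gD !add0r.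
have h0 : h 0 = 0 by apply: (addIr (h 0)); rewrite -hD !add0r.
have mulx0 x : mul x 0 = 0 by apply: (addIr (mul x 0)); rewrite -mulDr !add0r.
have mul0x x : mul 0 x = 0 by apply: (addIr (mul 0 x)); rewrite -mulDl !add0r.
split.
- split=> [x y z|x y z|x y]; rewrite !kE ?gD ?hD ?mulDl ?mulDr //.
  case/mul0 => e0; [left | right].
    by rewrite -(Kg x) e0 mul0x.
  by rewrite -(Kh y) e0 mulx0.
- by move=> x; rewrite -{1}(Kh x) kaplanskyE Kh.
- by move=> x; rewrite -{1}(Kg x) kaplanskyE Kg.
Qed.

End Kaplansky.

(* Main.v *)
Require Import Defs.
From HB Require Import structures.
From mathcomp Require Import all_boot all_order all_algebra.
From mathcomp Require Import cyclic finfield.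
From mathcomp Require Import ring.

Set Implicit Arguments.
Unset Strict Implicit.
Unset Printing Implicit Defensive.

Import GRing.Theory.
Local Open Scope ring_scope.

(** Write phi for x |-> x ^+ q and sigma for x |-> x ^+ (p ^ (m / 2)), so that
    x ^+ r = sigma (phi x). Three facts about these automorphisms of M carry
    everything: sigma is an involution; phi x = - x forces x = 0, because phi
    has odd order; and an element fixed by sigma is a square in M, because its
    discrete logarithm is a multiple of p ^ (m / 2) + 1. In particular a is a
    square and a / B is not.

    The product has no zero divisors ([familyS_presemifield]): a vanishing
    product of two nonzero vectors would make B a square.

    Hence Kaplansky's trick yields a commutative semifield, in which left and
    right nuclei agree, and its nuclei can be read off the product P itself
    ([middle_nucleusP], [left_nucleusP]): the middle nucleus consists of the
    maps psi with P (psi s) t = P s (psi t), the left nucleus of those psi for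
    which moreover P (psi s) t is a function of P s t.

    Evaluated on the coordinate axes, the self-adjointness of psi says that for
    each of its four components A the expression f (A x) u is symmetric in x and
    u, where f x u = tau x * u + b * (x * tau u) and tau is phi or sigma \o phi.
    Such a component is the multiplication by a constant c with tau c = b * c
    ([twisted_symmetric_scalar]). For the off-diagonal components b is a / B or
    its inverse, a nonsquare, so c = 0; for the diagonal ones b = 1, so c is
    fixed by phi. Comparing the two axes leaves
    psi (x, y) = (lam * x, sigma lam * y) with phi lam = lam
    ([selfadjoint_twisted_scale]). For the left nucleus the first coordinate
    of P, which is reached from both axes, forces sigma lam = lam, and both
    conditions together amount to lam ^+ r = lam.

    So the two nuclei are the subfields of M cut out by lam ^+ q = lam and
    lam ^+ r = lam. If e and d are the greatest common divisors with m of k and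
    of k + m / 2, these conditions mean lam ^+ (p ^ e) = lam and
    lam ^+ (p ^ d) = lam ([exp_fixed_gcd]), and the subfields are copies
    of E and D ([finField_subfield]). *)

(** * Finite fields: subfields, Frobenius maps and squares *)

Lemma prime_field_rmorphism (F : finFieldType) (p : nat) :
  p \in [pchar F] -> inhabited {rmorphism 'F_p -> F}.
Proof.
move=> pF; constructor.
exact: (GRing.in_alg (pPrimeCharType pF) :
  {rmorphism 'F_p -> pPrimeCharType pF}).
Qed.

Lemma expf_card_pred (F : finFieldType) (x : F) : x != 0 -> x ^+ #|F|.-1 = 1.
Proof.
move=> x0; apply: (mulfI x0); rewrite -exprS prednK ?expf_card ?mulr1 //.
by rewrite ltnW ?finNzRing_gt1.
Qed.

Lemma finField_prim_root (F : finFieldType) :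
  exists z : F, #|F|.-1.-primitive_root z.
Proof.
have cardF : #|F|.-1.+1 = #|F| by rewrite prednK // ltnW ?finNzRing_gt1.
have cardF0 : size [seq x <- enum F | x != 0] = #|F|.-1.
  rewrite (@eq_filter _ _ (predC1 0)) // -rem_filter ?enum_uniq //.
  by rewrite size_rem ?mem_enum // -cardE.
have : has #|F|.-1.-primitive_root [seq x <- enum F | x != 0].
  apply: has_prim_root; last by rewrite cardF0.
  - by rewrite -ltnS cardF finNzRing_gt1.
  - apply/allP => x; rewrite mem_filter => /andP[x0 _].
    exact/unity_rootP/expf_card_pred.
  - by rewrite filter_uniq ?enum_uniq.
by case/hasP => z _; exists z.
Qed.

(** This supplies the minimal polynomial of z over K. A least degree exists
    because K is finite, so that the polynomials of bounded size, coded as row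
    vectors, can be searched exhaustively. *)
Lemma root_ideal_generator (K F : finFieldType) (f : {rmorphism K -> F})
    (z : F) (P : {poly K}) : P != 0 -> root (map_poly f P) z ->
  exists2 h : {poly K}, h != 0 /\ root (map_poly f h) z &
    forall Q, root (map_poly f Q) z -> h %| Q.
Proof.
move=> P0 Pz.
pose good n :=
  [exists v : 'rV[K]_n, (v != 0) && root (map_poly f (rVpoly v)) z].
have goodP (Q : {poly K}) : Q != 0 -> root (map_poly f Q) z -> good (size Q).
  move=> Q0 Qz; apply/existsP; exists (poly_rV Q).
  rewrite poly_rV_K // Qz andbT; apply: contraNneq Q0 => eQ.
  by rewrite -(poly_rV_K (leqnn (size Q))) eQ linear0.
have [n /existsP[v /andP[v0 vz]] n_min] :=
  ex_minnP (ex_intro good _ (goodP P P0 Pz)).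
have h0 : rVpoly v != 0.
  by apply: contraNneq v0 => e; rewrite -(rVpolyK v) e linear0.
exists (rVpoly v) => // Q Qz; rewrite /dvdp; apply/contraT => m0.
have Qrz : root (map_poly f (Q %% rVpoly v)) z.
  move: Qz; rewrite {1}(divp_eq Q (rVpoly v)) rmorphD rmorphM /= !rootE.
  by rewrite !hornerE (rootP vz) mulr0 add0r.
have := n_min _ (goodP _ m0 Qrz); rewrite leqNgt.
by rewrite (leq_trans (ltn_modpN0 Q h0)) ?size_poly.
Qed.

(** F is generated over K by a primitive root z, whose minimal polynomial h
    divides 'X^#|M| - 'X and therefore has a root w in M; sending z to w is the
    embedding. *)
Lemma finField_embedding (K : finFieldType) (F M : finFieldType)
    (f : {rmorphism K -> F}) (g : {rmorphism K -> M}) :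
  (#|F|.-1 %| #|M|.-1)%N -> inhabited {rmorphism F -> M}.
Proof.
move=> dvdFM; have [z z_prim] := finField_prim_root F.
have n_gt0 := prim_order_gt0 z_prim.
have X0 : 'X^(#|F|.-1) - 1 != 0 :> {poly K}.
  by rewrite monic_neq0 ?monicXnsubC.
have Xz : root (map_poly f ('X^(#|F|.-1) - 1)) z.
  rewrite rmorphB /= map_polyXn rmorph1 rootE !hornerE.
  by rewrite (prim_expr_order z_prim) subrr.
have [h [h0 hz] h_min] := root_ideal_generator X0 Xz.
have [w hw] : exists w, root (map_poly g h) w.
  have : h %| 'X^#|M| - 'X.
    apply: h_min; rewrite rmorphB /= map_polyXn map_polyX rootE !hornerE.
    have M_gt0 : (0 < #|M|)%N by rewrite ltnW ?finNzRing_gt1.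
    have /eqP zM : z ^+ #|M|.-1 == 1 by rewrite -(prim_order_dvd z_prim).
    by rewrite -(prednK M_gt0) exprS zM mulr1 subrr.
  rewrite -(dvdp_map g) rmorphB /= map_polyXn map_polyX finField_genPoly.
  case/dvdp_prod_XsubC => s hs.
  have : size (map_poly g h) != 1%N.
    rewrite size_map_poly -(size_map_poly f) gtn_eqF //.
    by apply: root_size_gt1 hz; rewrite map_poly_eq0.
  case: (mask s _) hs => [|w r] hs.
    by rewrite (eqp_size hs) big_nil size_poly1.
  by exists w; rewrite (eqp_root hs) big_cons rootM root_XsubC eqxx.
have evalE P Q : (map_poly f P).[z] = (map_poly f Q).[z] ->
    (map_poly g P).[w] = (map_poly g Q).[w].
  move=> ePQ; have /dvdpP[c eP]: h %| P - Q.
    by apply: h_min; rewrite rootE rmorphB /= hornerD hornerN ePQ subrr.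
  apply/eqP; rewrite -subr_eq0 -hornerN -hornerD -rmorphB /= eP.
  by rewrite rmorphM /= hornerM (rootP hw) mulr0.
have lift y : {P : {poly K} | (map_poly f P).[z] = y}.
  have [->|y0] := eqVneq y 0; first by exists 0; rewrite rmorph0 horner0.
  have /(prim_rootP z_prim)[i ->] := expf_card_pred y0.
  by exists 'X^i; rewrite map_polyXn hornerXn.
pose j y := (map_poly g (sval (lift y))).[w].
have jE P : j (map_poly f P).[z] = (map_poly g P).[w].
  by apply: evalE; case: (lift _).
have jB : zmod_morphism j.
  move=> x y; rewrite -(svalP (lift x)) -(svalP (lift y)).
  by rewrite -hornerN -hornerD -rmorphB /= !jE rmorphB /= hornerD hornerN.
have jM : monoid_morphism j.
  split=> [|x y].
    by have := jE 1; rewrite !rmorph1 !hornerC.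
  rewrite -(svalP (lift x)) -(svalP (lift y)) -hornerM -rmorphM /= !jE.
  by rewrite rmorphM /= hornerM.
pose jBm := GRing.isZmodMorphism.Build F M j jB.
pose jMm := GRing.isMonoidMorphism.Build F M j jM.
pose j' : {rmorphism F -> M} := HB.pack j jBm jMm.
by constructor.
Qed.

(** The polynomial 'X^(p ^ n) - 'X splits over F with the elements of F as its
    roots, so over M its roots are the images of these elements. *)
Lemma finField_subfield (p m n : nat) (F M : finFieldType) :
    prime p -> #|F| = (p ^ n)%N -> #|M| = (p ^ m)%N -> (n %| m)%N ->
  exists j : {rmorphism F -> M},
    forall x, (x ^+ (p ^ n) == x) = (x \in codom j).
Proof.
move=> p_prime cardF cardM /dvdnP[c m_eq].
have [f] := prime_field_rmorphism (card_finPcharP cardF p_prime).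
have [g] := prime_field_rmorphism (card_finPcharP cardM p_prime).
case: (@finField_embedding _ F M f g) => [|j].
  by rewrite cardF cardM m_eq mulnC expnM (predn_exp (p ^ n) c) dvdn_mulr.
exists j => x; have := congr1 (map_poly j) (finField_genPoly F).
rewrite rmorphB /= map_polyXn map_polyX cardF.
have -> : map_poly j (\prod_y ('X - y%:P)) =
          \prod_(y <- codom j) ('X - y%:P).
  rewrite rmorph_prod big_image /=; apply: eq_bigr => y _.
  by rewrite rmorphB /= map_polyX map_polyC.
by move/(congr1 (root^~ x)); rewrite root_prod_XsubC rootE !hornerE subr_eq0.
Qed.

Lemma exp_fixed_iter (R : nzRingType) (x : R) (p k c : nat) :
  x ^+ (p ^ k) = x -> x ^+ (p ^ (k * c)) = x.
Proof.
move=> xk; elim: c => [|c IHc]; first by rewrite muln0 expr1.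
by rewrite mulnS expnD exprM xk.
Qed.

(** x ^+ (p ^ m) = x holds for every x in M; now use a Bezout relation between
    k and m. *)
Lemma exp_fixed_gcd (M : finFieldType) (x : M) (p k m : nat) :
    (0 < m)%N -> #|M| = (p ^ m)%N ->
  (x ^+ (p ^ k) == x) = (x ^+ (p ^ gcdn k m) == x).
Proof.
move=> m_gt0 cardM; apply/eqP/eqP => xk; last first.
  by have /dvdnP[c ->] := dvdn_gcdl k m; rewrite mulnC exp_fixed_iter.
have [a _ /dvdnP[c]] := Bezoutl k m_gt0; rewrite gcdnC => ekm.
have := @exp_fixed_iter _ x p m c.
rewrite -cardM expf_card mulnC -ekm => /(_ erefl).
by rewrite addnC expnD exprM mulnC exp_fixed_iter.
Qed.

Lemma frobenius_rmorphism (R : comNzRingType) (p j : nat) :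
    p \in [pchar R] ->
  exists tau : {rmorphism R -> R}, forall x, x ^+ (p ^ j) = tau x.
Proof.
move=> pR; elim: j => [|j [tau tauE]]; first by exists idfun.
exists (pFrobenius_aut pR \o tau) => x.
by rewrite /= pFrobenius_autE -tauE -exprM -expnSr.
Qed.

Definition is_square (R : pzRingType) (x : R) : Prop := exists z, x = z ^+ 2.

Lemma is_squareM (R : comPzRingType) (x y : R) :
  is_square x -> is_square y -> is_square (x * y).
Proof. by case=> z -> [t ->]; exists (z * t); rewrite exprMn. Qed.

Lemma is_squareV (K : fieldType) (x : K) : is_square x -> is_square x^-1.
Proof. by case=> z ->; exists z^-1; rewrite exprVn. Qed.

Lemma is_square_Xodd (R : pzRingType) (x : R) (n : nat) :
  odd n -> is_square (x * x ^+ n).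
Proof.
move=> n_odd; exists (x ^+ n.+1./2).
by rewrite -exprS -exprM muln2 halfK /= n_odd subn0.
Qed.

(** If x = z ^+ i with z a primitive root, then p ^ (h * 2) - 1 divides
    i * (p ^ h - 1), so i is a multiple of the even number p ^ h + 1. *)
Lemma exp_fixed_is_square (M : finFieldType) (p h : nat) (x : M) :
    odd p -> #|M| = (p ^ (h * 2))%N -> x ^+ (p ^ h) = x ->
  is_square x.
Proof.
move=> p_odd cardM xh; have [z z_prim] := finField_prim_root M.
have [->|x0] := eqVneq x 0; first by exists 0; rewrite expr0n.
have [i xE] : exists i, x = z ^+ i.
  by have /(prim_rootP z_prim)[i ->] := expf_card_pred x0; exists i.
have P_gt1 : (1 < p ^ h)%N.
  by have := finNzRing_gt1 M; rewrite cardM expnM -{1}(exp1n 2) ltn_exp2r.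
have card1 : #|M|.-1 = ((p ^ h + 1) * (p ^ h - 1))%N.
  by rewrite cardM expnM -subn1 -{2}(exp1n 2) subn_sqr mulnC.
have : (#|M|.-1 %| i * p ^ h - i)%N.
  rewrite -eqn_mod_dvd ?leq_pmulr ?(ltnW P_gt1) //.
  by rewrite -(eq_prim_root_expr z_prim) exprM -xE xh.
rewrite -{2}[i]muln1 -mulnBr card1 dvdn_pmul2r ?subn_gt0 // => dvd_i.
have i_even : ~~ odd i.
  rewrite -dvdn2; apply: dvdn_trans dvd_i.
  by rewrite dvdn2 addn1 /= oddX p_odd orbT.
by exists (z ^+ i./2); rewrite -exprM muln2 even_halfK.
Qed.

Lemma frobenius_nontrivial (M : finFieldType) (p k m : nat) :
    (1 < p)%N -> (0 < k < m)%N -> #|M| = (p ^ m)%N ->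
  exists theta : M, theta ^+ (p ^ k) != theta.
Proof.
move=> p_gt1 /andP[k_gt0 ltkm] cardM; have [z z_prim] := finField_prim_root M.
exists z; apply/negP => /eqP zk.
have pk_gt1 : (1 < p ^ k)%N by rewrite -{1}(expn0 p) ltn_exp2l.
have : (#|M|.-1 %| p ^ k - 1)%N.
  rewrite -eqn_mod_dvd ?(ltnW pk_gt1) //.
  by rewrite -(eq_prim_root_expr z_prim) zk.
move/dvdn_leq; rewrite subn_gt0 pk_gt1 cardM -subn1 => /(_ isT).
have lt_pkm : (p ^ k < p ^ m)%N by rewrite ltn_exp2l.
by rewrite leqNgt ltn_sub2r // (ltn_trans pk_gt1).
Qed.

(** Iterate the map x |-> x ^+ (p ^ k) an odd number m / gcd(k, m) of times:
    this is the identity since m divides k * (m / gcd(k, m)), but it also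
    changes the sign of x. *)
Lemma frobenius_eqN (M : finFieldType) (p k m : nat) (x : M) :
    prime p -> odd p -> (0 < m)%N -> #|M| = (p ^ m)%N ->
    odd (m %/ gcdn k m) ->
  x ^+ (p ^ k) = - x -> x = 0.
Proof.
move=> p_prime p_odd m_gt0 cardM n_odd xk.
have iter i : x ^+ (p ^ (k * i)) = (-1) ^+ i * x.
  elim: i => [|i IHi]; first by rewrite muln0 expr1 mul1r.
  rewrite mulnS expnD exprM xk (exprNn x) IHi mulrA; congr (_ * _).
  by rewrite exprS -signr_odd oddX p_odd orbT.
have xm : x ^+ (p ^ m) = x by rewrite -cardM expf_card.
have := iter (m %/ gcdn k m)%N; rewrite muln_divCA_gcd exp_fixed_iter //.
rewrite -signr_odd n_odd expr1 mulN1r => /eqP.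
rewrite -addr_eq0 -mulr2n -mulr_natr mulf_eq0 => /orP[/eqP //|].
rewrite -(dvdn_pcharf (card_finPcharP cardM p_prime)).
move=> /dvdn_leq => /(_ isT) p_le2.
have p2 : p = 2%N by apply/eqP; rewrite eqn_leq p_le2 prime_gt1.
by rewrite p2 in p_odd.
Qed.

(** * The nuclei of a commutative pre-semifield *)

Section Kaplansky.
Variables (V : finZmodType) (mul : V -> V -> V) (eps : V).
Hypotheses (pmul : presemifield mul) (mulC : commutative mul).
Hypothesis eps0 : eps != 0.

Local Notation circ := (kaplansky mul eps).

Lemma kaplanskyC_E x y : circ (mul x eps) (mul y eps) = mul x y.
Proof. by rewrite (mulC y) kaplanskyE. Qed.

Lemma kaplanskyC : commutative circ.
Proof.
have [g _ gK] := injF_bij (presemifield_mulIr pmul eps0).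
by move=> x y; rewrite -(gK x) -(gK y) /= !kaplanskyC_E mulC.
Qed.

Lemma left_nucleus_eq_right : left_nucleus circ = right_nucleus circ.
Proof.
apply/setP => x; rewrite !inE.
apply/forallP/forallP => nx y; apply/forallP => z.
  rewrite (kaplanskyC _ x) (kaplanskyC z x) (kaplanskyC y (circ x z)).
  by rewrite (kaplanskyC y z) eq_sym; apply: (forallP (nx z)).
rewrite (kaplanskyC x (circ y z)) (kaplanskyC _ z) (kaplanskyC x y).
by rewrite (kaplanskyC y z) eq_sym; apply: (forallP (nx z)).
Qed.

(** psi is the operator of multiplication by c, transported along the bijection
    x |-> mul x eps. As circ (mul x eps) (mul z eps) = mul x z, associativity
    around c becomes the self-adjointness of psi; as mul eps eps is the
    identity element, c is recovered from psi eps. *)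
Lemma middle_nucleusP c :
  reflect (exists2 psi : V -> V, forall x z, mul (psi x) z = mul x (psi z)
             & c = mul (psi eps) eps)
          (c \in middle_nucleus circ).
Proof.
pose g := invF (presemifield_mulIr pmul eps0).
have Kg y : mul (g y) eps = y.
  exact: (f_invF (presemifield_mulIr pmul eps0)).
have epsE x : circ (mul eps eps) x = x by rewrite -(Kg x) kaplanskyC_E mulC.
rewrite inE; apply: (iffP forallP) => [nc|[psi psiE ->] x].
  exists (fun x => g (circ (mul x eps) c)) => [x z|]; last by rewrite Kg epsE.
  rewrite -(kaplanskyC_E _ z) -(kaplanskyC_E x (g _)) !Kg.
  rewrite (kaplanskyC (mul z eps) c).
  exact: (eqP (forallP (nc (mul x eps)) (mul z eps))).
have psi_mul w : circ (mul w eps) (mul (psi eps) eps) = mul (psi w) eps.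
  by rewrite kaplanskyC_E psiE.
apply/forallP => z; rewrite -(Kg x) -(Kg z) psi_mul kaplanskyC_E.
by rewrite (kaplanskyC (mul (psi eps) eps)) psi_mul kaplanskyC_E psiE.
Qed.

(** Here chi is multiplication by c itself, and psi is the same operator
    transported along x |-> mul x eps. *)
Lemma left_nucleusP c :
  reflect (exists psi : V -> V, exists2 chi : V -> V,
             forall x z, mul (psi x) z = chi (mul x z) & c = mul (psi eps) eps)
          (c \in left_nucleus circ).
Proof.
pose g := invF (presemifield_mulIr pmul eps0).
have Kg y : mul (g y) eps = y.
  exact: (f_invF (presemifield_mulIr pmul eps0)).
have epsE x : circ x (mul eps eps) = x by rewrite -(Kg x) kaplanskyC_E.
rewrite inE; apply: (iffP forallP) => [nc|[psi [chi psiE ->]] x].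
  exists (fun x => g (circ c (mul x eps))), (circ c) => [x z|]; last first.
    by rewrite Kg epsE.
  rewrite -(kaplanskyC_E (g _) z) -(kaplanskyC_E x z) Kg.
  exact: (eqP (forallP (nc (mul x eps)) (mul z eps))).
have cE w : circ (mul (psi eps) eps) w = chi w.
  by rewrite -(Kg w) kaplanskyC_E psiE mulC.
apply/forallP => z; rewrite !cE -(Kg x) -(Kg z) kaplanskyC_E.
by rewrite -psiE kaplanskyC_E psiE.
Qed.

End Kaplansky.

(** * Maps symmetric for a twisted bilinear form *)

(** Dedekind's independence of the automorphisms id, tau, tau^2, made explicit:
    the relations at u = 1, theta, theta ^+ 2 form a Vandermonde system. *)
Lemma fmorph_powers_independent (K : fieldType) (tau : {rmorphism K -> K})
    (theta a b c : K) : tau (tau theta) != theta ->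
    (forall u, a * tau (tau u) + b * tau u + c * u = 0) ->
  [/\ a = 0, b = 0 & c = 0].
Proof.
move=> theta2 H.
have theta1 : tau theta != theta by apply: contraNneq theta2 => e; rewrite !e.
have theta12 : tau (tau theta) != tau theta.
  by rewrite (inj_eq (fmorph_inj tau)).
have := H 1; have := H theta; have := H (theta ^+ 2).
rewrite !rmorphXn !rmorph1 !mulr1.
set x := tau (tau theta) in theta2 theta12 *.
set y := tau theta in theta1 theta12 *; move=> e2 e1 e0.
have ha : a * ((x - y) * (x - theta)) = 0.
  transitivity (a * x ^+ 2 + b * y ^+ 2 + c * theta ^+ 2
    - (y + theta) * (a * x + b * y + c * theta) + y * theta * (a + b + c)).
    by ring.
  by rewrite e2 e1 e0; ring.
have hb : b * ((x - y) * (theta - y)) = 0.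
  transitivity (a * x ^+ 2 + b * y ^+ 2 + c * theta ^+ 2
    - (x + theta) * (a * x + b * y + c * theta) + x * theta * (a + b + c)).
    by ring.
  by rewrite e2 e1 e0; ring.
have hc : c * ((theta - y) * (theta - x)) = 0.
  transitivity (a * x ^+ 2 + b * y ^+ 2 + c * theta ^+ 2
    - (x + y) * (a * x + b * y + c * theta) + x * y * (a + b + c)).
    by ring.
  by rewrite e2 e1 e0; ring.
have [xy xt yt] : [/\ x - y != 0, x - theta != 0 & y - theta != 0].
  by rewrite !subr_eq0.
have cancel (u v w : K) : v != 0 -> w != 0 -> u * (v * w) = 0 -> u = 0.
  by move=> v0 w0 /eqP; rewrite !mulf_eq0 (negPf v0) (negPf w0) !orbF => /eqP.
by split; [apply: cancel ha | apply: cancel hb | apply: cancel hc];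
   rewrite // -opprB oppr_eq0.
Qed.

(** At x = 1 the identity gives tau (A u) in terms of A u, tau u and u; after
    that substitution, at x = theta it expresses A u as a combination of u and
    tau u. Feeding this back into the identity at x = 1, the independence of id,
    tau, tau^2 kills the coefficient of tau u and determines the other one. *)
Lemma twisted_symmetric_scalar (K : fieldType) (tau : {rmorphism K -> K})
    (theta b : K) (A : K -> K) : tau (tau theta) != theta -> b != 0 ->
    (forall x u, tau (A x) * u + b * (A x * tau u)
               = x * tau (A u) + b * (tau x * A u)) ->
  exists2 c, forall x, A x = c * x & tau c = b * c.
Proof.
move=> theta2 b0 H.
have theta1 : tau theta - theta != 0.
  by rewrite subr_eq0; apply: contraNneq theta2 => e; rewrite !e.
have H1 u : tau (A 1) * u + b * (A 1 * tau u) = tau (A u) + b * A u.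
  by rewrite H rmorph1 !mul1r.
pose al := (A theta - theta * A 1) / (tau theta - theta).
pose be := (tau (A theta) - theta * tau (A 1)) / (b * (tau theta - theta)).
have AE u : A u = be * u + al * tau u.
  have e : b * (tau theta - theta) * A u =
      (tau (A theta) - theta * tau (A 1)) * u
      + b * (A theta - theta * A 1) * tau u.
    transitivity (theta * tau (A u) + b * (tau theta * A u)
      - theta * (tau (A u) + b * A u)); first by ring.
    by rewrite -H -H1; ring.
  rewrite /be /al; apply: (mulfI (mulf_neq0 b0 theta1)); rewrite e; field.
  by rewrite theta1 b0.
have [al0 e1 _] : [/\ tau al = 0, tau be + b * al - b * A 1 = 0
                    & b * be - tau (A 1) = 0].
  apply: (fmorph_powers_independent theta2) => u.
  transitivity (tau (be * u + al * tau u) + b * (be * u + al * tau u)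
     - (tau (A 1) * u + b * (A 1 * tau u))); first by ring.
  by rewrite -AE H1 subrr.
have {}al0 : al = 0 by apply/eqP; rewrite -(fmorph_eq0 tau) al0.
have {}AE u : A u = be * u by rewrite AE al0 mul0r addr0.
exists be => //; move: e1; rewrite al0 AE mulr1 mulr0 addr0.
by move/eqP; rewrite subr_eq0 => /eqP.
Qed.

(** * The products of Family S *)

Section FamilyS.
Variables (M : finFieldType) (q r : nat) (phi sigma : {rmorphism M -> M}).
Hypotheses (q_odd : odd q) (r_odd : odd r).
Hypotheses (phiE : forall x, x ^+ q = phi x).
Hypotheses (rE : forall x, x ^+ r = sigma (phi x)).
Hypotheses (sigmaK : involutive sigma).
Hypothesis phi_eqN : forall x, phi x = - x -> x = 0.
Hypothesis fixed_square : forall x, sigma x = x -> is_square x.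

Variables (B a : M).
Hypotheses (B_nonsquare : ~ is_square B) (a_fixed : sigma a = a) (a0 : a != 0).

Local Notation P := (familyS_mul q r B a).

Lemma sigma_phi x : sigma (phi x) = phi (sigma x).
Proof. by rewrite -!phiE rmorphXn. Qed.

(** The element phi x - x is negated by phi. *)
Lemma phi2_eq x : phi (phi x) = x -> phi x = x.
Proof.
move=> e; apply/eqP; rewrite -subr_eq0; apply/eqP/phi_eqN.
by rewrite rmorphB e opprB.
Qed.

(** phi and sigma commute, so the square of sigma \o phi is that of phi. *)
Lemma sigma_phi_fixed x : sigma (phi x) = x -> phi x = x.
Proof. by move=> e; apply: phi2_eq; rewrite -[phi x]sigmaK e -sigma_phi e. Qed.

Lemma B_neq0 : B != 0.
Proof. by apply/eqP => e; apply: B_nonsquare; exists 0; rewrite e expr0n. Qed.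

Lemma fixed_div_nonsquare c : c != 0 -> sigma c = c -> ~ is_square (c / B).
Proof.
move=> c0 cs cB; apply: B_nonsquare.
have -> : B = c * (c / B)^-1 by rewrite invfM invrK mulrA divff ?mul1r.
by apply: is_squareM (is_squareV cB); apply: fixed_square.
Qed.

(** Otherwise v / y would be a nonzero element negated by phi. *)
Lemma phi_add_eq0 y v : y != 0 -> phi y * v + y * phi v = 0 -> v = 0.
Proof.
move=> y0 e; have py0 : phi y != 0 by rewrite fmorph_eq0.
suff: v / y = 0 by move/eqP; rewrite mulf_eq0 invr_eq0 (negPf y0) orbF => /eqP.
apply: phi_eqN; rewrite rmorphM fmorphV.
apply: (mulfI (mulf_neq0 y0 py0)); apply/eqP; rewrite -subr_eq0; apply/eqP.
by rewrite -e; field; rewrite y0 py0.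
Qed.

(** Otherwise - a / B would be, up to squares, the product of u ^+ r.+1 and
    y ^+ r.+1, hence a square; but - a is fixed by sigma, hence a square,
    and B is not. *)
Lemma twist_add_eq0 (y u : M) :
  y * sigma (phi u) + a / B * (sigma (phi y) * u) = 0 -> y = 0 \/ u = 0.
Proof.
have [->|y0] := eqVneq y 0; first by left.
have [->|u0] := eqVneq u 0; first by right.
move=> e; exfalso.
have u0' : sigma (phi u) != 0 by rewrite !fmorph_eq0.
have y0' : sigma (phi y) != 0 by rewrite !fmorph_eq0.
apply: (@fixed_div_nonsquare (- a)); rewrite ?oppr_eq0 ?rmorphN ?a_fixed //.
have -> : - a / B = (u * sigma (phi u)) * (y * sigma (phi y))
                    / (u * sigma (phi y)) ^+ 2.
  apply/eqP; rewrite -subr_eq0; apply/eqP.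
  transitivity (- (y * sigma (phi u) + a / B * (sigma (phi y) * u))
                / (u * sigma (phi y))).
    by field; rewrite u0 y0' B_neq0.
  by rewrite e oppr0 mul0r.
rewrite -!rE; apply: is_squareM; last first.
  by apply: is_squareV; exists (u * y ^+ r).
by apply: is_squareM; apply: is_square_Xodd.
Qed.

Lemma familyS_mulC : commutative P.
Proof. by move=> [x y] [u v] /=; congr pair; ring. Qed.

(** Put w = sigma s, al = w + phi w, be = t + phi t, T = t + phi w and
    S = phi t + w. The first coordinate says that B is - (sigma al / be) up to
    squares. Multiplying the two coordinates eliminates B and shows that
    l = T * S / (al * be) is fixed by sigma, so that l - 1 is a square. The
    identity T * S - al * be = (t - w) * phi (t - w) now makes
    (l - 1) * (al * be) a square, hence al * be too (if l = 1 then t = w and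
    al = be), hence B. *)
Lemma familyS_no_zero_divisors_off_axes x y s t : x != 0 -> y != 0 ->
  P (x, y) (x * s, y * t) = 0 -> s = 0 /\ t = 0.
Proof.
move=> x0 y0 [] /=; rewrite !phiE !rE => e1 e2.
pose w := sigma s; pose al := w + phi w; pose be := t + phi t.
pose T := t + phi w; pose S := phi t + w.
have sw : sigma w = s by rewrite sigmaK.
have px0 : phi x != 0 by rewrite fmorph_eq0.
have py0 : phi y != 0 by rewrite fmorph_eq0.
have spx0 : phi (sigma x) != 0 by rewrite !fmorph_eq0.
have spy0 : phi (sigma y) != 0 by rewrite !fmorph_eq0.
have {}e1 : x * phi x * sigma al = - (B * (y * phi y * be)).
  apply/eqP; rewrite -subr_eq0 -e1 /al /be rmorphD sigma_phi sw; apply/eqP.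
  ring.
have {}e2 : B * (phi (sigma x) * y * T) = - (a * (x * phi (sigma y) * sigma S)).
  have -> : B * (phi (sigma x) * y * T) =
      B * (sigma (phi x) * (y * t) + y * sigma (phi (x * s)) +
           a / B * (x * sigma (phi (y * t)) + sigma (phi y) * (x * s)))
      - a * (x * phi (sigma y) * sigma S).
    rewrite /T /S [sigma (_ + w)]rmorphD /= sw !sigma_phi !rmorphM /= -/w.
    field; exact: B_neq0.
  by rewrite e2 mulr0 add0r.
have [be0|be0] := eqVneq be 0.
  have al0 : al = 0.
    apply/eqP; rewrite -(fmorph_eq0 sigma); move/eqP: e1.
    by rewrite be0 !mulr0 oppr0 !mulf_eq0 (negPf x0) (negPf px0).
  have fix0 z : z + phi z = 0 -> z = 0.
    by move/eqP; rewrite addrC addr_eq0 => /eqP/phi_eqN.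
  by rewrite (fix0 _ be0) -sw (fix0 _ al0) rmorph0.
have al0 : al != 0.
  apply: contraNneq be0 => al0; move/eqP: e1.
  rewrite al0 rmorph0 mulr0 eq_sym oppr_eq0 !mulf_eq0.
  by rewrite (negPf y0) (negPf py0) (negPf B_neq0).
case: B_nonsquare.
have sal0 : sigma al != 0 by rewrite fmorph_eq0.
have sbe0 : sigma be != 0 by rewrite fmorph_eq0.
have albe_square : is_square (al * be).
  pose l := T * S / (al * be).
  have l_fixed : sigma l = l.
    (* The product of e1 and e2 with B * x * y cancelled. *)
    have e : phi (x * sigma x) * (sigma al * T)
           = a * phi (y * sigma y) * (be * sigma S).
      have xyB : x * (B * y) != 0 by rewrite !mulf_neq0 ?B_neq0.
      apply: (mulfI xyB); rewrite !rmorphM.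
      transitivity ((x * phi x * sigma al) * (B * (phi (sigma x) * y * T))).
        by ring.
      by rewrite e1 e2; ring.
    have n1_fixed : sigma (phi (x * sigma x)) = phi (x * sigma x).
      by rewrite sigma_phi rmorphM sigmaK mulrC.
    have n2_fixed : sigma (a * phi (y * sigma y)) = a * phi (y * sigma y).
      by rewrite rmorphM a_fixed sigma_phi rmorphM sigmaK [sigma y * _]mulrC.
    have se : phi (x * sigma x) * (al * sigma T)
            = a * phi (y * sigma y) * (sigma be * S).
      by rewrite -n1_fixed -n2_fixed -[al]sigmaK -[S]sigmaK -!rmorphM e.
    rewrite /l fmorph_div !rmorphM; apply/eqP.
    rewrite eqr_div ?mulf_neq0 //; apply/eqP.
    have n0 : phi (x * sigma x) * (a * phi (y * sigma y)) != 0.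
      by rewrite !mulf_neq0 // !rmorphM !mulf_neq0.
    apply: (mulfI n0).
    transitivity ((phi (x * sigma x) * (al * sigma T))
                  * (a * phi (y * sigma y) * (be * sigma S))); first by ring.
    by rewrite -e se; ring.
  have id_albe : (l - 1) * (al * be) = (t - w) * (t - w) ^+ q.
    rewrite phiE /l mulrBl mul1r mulfVK ?mulf_neq0 // /T /S /al /be.
    by rewrite rmorphB /=; ring.
  have [l1|l1] := eqVneq l 1.
    have tw : t = w.
      move/eqP: id_albe; rewrite l1 subrr mul0r eq_sym mulf_eq0.
      rewrite expf_eq0 subr_eq0; by case/orP => [/eqP //|/andP[_ /eqP //]].
    by exists al; rewrite /be tw.
  have l1' : l - 1 != 0 by rewrite subr_eq0.
  rewrite -[al * be](mulKf l1') id_albe.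
  apply: is_squareM (is_square_Xodd _ q_odd).
  by apply/is_squareV/fixed_square; rewrite rmorphB rmorph1 l_fixed.
have -> : B = -1 * (x * x ^+ q) * (al * sigma al) * (al * be)
              * ((y * y ^+ q) * (al * be) ^+ 2)^-1.
  rewrite !phiE; apply: (mulIf (mulf_neq0 (mulf_neq0 y0 py0) be0)).
  transitivity (- (x * phi x * sigma al)); first by rewrite e1 opprK; ring.
  by field; rewrite y0 py0 al0 be0.
apply: is_squareM; last first.
  by apply/is_squareV/is_squareM; [apply: is_square_Xodd | exists (al * be)].
apply: is_squareM => //; apply: is_squareM; last first.
  by apply: fixed_square; rewrite rmorphM sigmaK mulrC.
apply: is_squareM (is_square_Xodd _ q_odd).
by apply: fixed_square; rewrite rmorphN rmorph1.
Qed.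

Lemma familyS_presemifield : presemifield P.
Proof.
have PDl : left_distributive P +%R.
  move=> [x y] [x' y'] [u v] /=; congr pair.
    by rewrite /= !phiE !rmorphD; ring.
  by rewrite /= !rE !rmorphD; ring.
split=> [//|s t t'|]; first by rewrite !(familyS_mulC s) PDl.
move=> [x y] [u v] e.
have [x0|x0] := eqVneq x 0; have [y0|y0] := eqVneq y 0.
- by left; rewrite x0 y0.
- right; move: e; rewrite x0 /= !phiE !rE !rmorph0 => -[e1 e2].
  have v0 : v = 0.
    apply: phi_add_eq0 y0 _; apply: (mulfI B_neq0); rewrite mulr0 -e1; ring.
  have [y00|u0] : y = 0 \/ u = 0 by apply: twist_add_eq0; rewrite -e2; ring.
    by rewrite y00 eqxx in y0.
  by rewrite v0 u0.
- right; move: e; rewrite y0 /= !phiE !rE !rmorph0 => -[e1 e2].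
  have u0 : u = 0 by apply: phi_add_eq0 x0 _; rewrite -e1; ring.
  have [v0|x00] : v = 0 \/ x = 0 by apply: twist_add_eq0; rewrite -e2; ring.
    by rewrite v0 u0.
  by rewrite x00 eqxx in x0.
- right; move: e; rewrite -[u](mulVKf x0) -[v](mulVKf y0).
  by case/(familyS_no_zero_divisors_off_axes x0 y0) => -> ->; rewrite !mulr0.
Qed.

Definition twisted_scale (lam : M) (s : M * M) : M * M :=
  (lam * s.1, sigma lam * s.2).

Lemma twisted_scale_selfadjoint lam s t : phi lam = lam ->
  P (twisted_scale lam s) t = P s (twisted_scale lam t).
Proof.
case: s t => [x y] [u v] lam_fixed.
have slam_fixed : phi (sigma lam) = sigma lam by rewrite -sigma_phi lam_fixed.
rewrite /= !phiE !rE !rmorphM !(sigma_phi, sigmaK, lam_fixed, slam_fixed).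
by congr pair; ring.
Qed.

Lemma twisted_scale_mull lam s t : phi lam = lam -> sigma lam = lam ->
  P (twisted_scale lam s) t = twisted_scale lam (P s t).
Proof.
case: s t => [x y] [u v] phil sigl.
by rewrite /twisted_scale /= !phiE !rE !rmorphM !(phil, sigl); congr pair; ring.
Qed.

Hypothesis phi_nontrivial : exists theta, phi theta != theta.

(** Restricting self-adjointness to pairs of vectors on the axes gives one
    identity of the form treated by [twisted_symmetric_scalar] for each of the
    four components A, C, F, G of psi. A scalar c with
    sigma (phi c) = a / B * c, or with the inverse factor, must vanish, since
    r is odd and a / B is not a square; so C = F = 0. The pairs with one vector
    on each axis relate the scalars of A and G. *)
Lemma selfadjoint_twisted_scale (psi : M * M -> M * M) :
    (forall s t, P (psi s) t = P s (psi t)) ->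
  exists2 lam, phi lam = lam & psi =1 twisted_scale lam.
Proof.
move=> psiE; have [theta theta1] := phi_nontrivial.
have theta2 : phi (phi theta) != theta.
  by apply: contraNneq theta1 => /phi2_eq ->.
have tau_theta2 : sigma (phi (sigma (phi theta))) != theta.
  by rewrite sigma_phi sigmaK.
have [PDl _ _] := familyS_presemifield.
have psiD s t : psi (s + t) = psi s + psi t.
  have eps0 : (1, 0) != 0 :> M * M by rewrite xpair_eqE oner_eq0.
  apply: (presemifield_mulIr familyS_presemifield eps0).
  by rewrite PDl !psiE PDl.
pose A x := (psi (x, 0)).1; pose F x := (psi (x, 0)).2.
pose C y := (psi (0, y)).1; pose G y := (psi (0, y)).2.
have psi1 x : psi (x, 0) = (A x, F x) by rewrite /A /F; case: (psi _).
have psi2 y : psi (0, y) = (C y, G y) by rewrite /C /G; case: (psi _).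
have [lam AE lam_fixed] : exists2 c, forall x, A x = c * x & phi c = 1 * c.
  apply: (twisted_symmetric_scalar theta2 (oner_neq0 _)) => x u.
  have := psiE (x, 0) (u, 0); rewrite !psi1 /= !phiE !rE !rmorph0 => -[e _].
  transitivity (phi (A x) * u + A x * phi u
                + B * (phi (F x) * 0 + F x * 0)); first by ring.
  by rewrite e; ring.
have [mu GE _] : exists2 c, forall x, G x = c * x & phi c = 1 * c.
  apply: (twisted_symmetric_scalar theta2 (oner_neq0 _)) => x u.
  have := psiE (0, x) (0, u); rewrite !psi2 /= !phiE !rE !rmorph0 => -[e _].
  apply: (mulfI B_neq0).
  transitivity (phi (C x) * 0 + C x * 0
                + B * (phi (G x) * u + G x * phi u)); first by ring.
  by rewrite e; ring.
pose tau : {rmorphism M -> M} := sigma \o phi.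
have tauE x : sigma (phi x) = tau x by [].
have b0 : a / B != 0 by rewrite mulf_neq0 ?invr_eq0 ?B_neq0.
have [c CE c_eq] : exists2 c, forall x, C x = c * x & tau c = a / B * c.
  apply: (twisted_symmetric_scalar (tau := tau) tau_theta2 b0) => x u.
  have := psiE (0, x) (0, u); rewrite !psi2 /= !phiE !rE !rmorph0 => -[_ e].
  transitivity (sigma (phi (C x)) * u + G x * 0
    + a / B * (C x * sigma (phi u) + sigma (phi (G x)) * 0)).
    by rewrite /=; ring.
  by rewrite e /=; ring.
have [f FE f_eq] : exists2 c, forall x, F x = c * x & tau c = B / a * c.
  have b'0 : B / a != 0 by rewrite mulf_neq0 ?invr_eq0 ?B_neq0.
  apply: (twisted_symmetric_scalar (tau := tau) tau_theta2 b'0) => x u.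
  have := psiE (x, 0) (u, 0); rewrite !psi1 /= !phiE !rE !rmorph0 => -[_ e].
  apply: (mulfI b0).
  transitivity (sigma (phi (A x)) * 0 + F x * sigma (phi u)
    + a / B * (A x * 0 + sigma (phi (F x)) * u)).
    by rewrite /=; field; rewrite B_neq0 a0.
  by rewrite e /=; field; rewrite B_neq0 a0.
have c0 : c = 0.
  apply/eqP/contraT => c0; case: (@fixed_div_nonsquare a) => //.
  have -> : a / B = (c * c ^+ r) / c ^+ 2.
    by rewrite rE tauE c_eq; field; rewrite c0 B_neq0.
  by apply: is_squareM (is_square_Xodd _ r_odd) _; apply: is_squareV; exists c.
have f0 : f = 0.
  apply/eqP/contraT => f0; case: (@fixed_div_nonsquare a) => //.
  have -> : a / B = f ^+ 2 / (f * f ^+ r).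
    by rewrite rE tauE f_eq; field; rewrite f0 B_neq0 a0.
  by apply: is_squareM; [exists f | apply/is_squareV/is_square_Xodd].
have {}lam_fixed : phi lam = lam by rewrite lam_fixed mul1r.
have mu_eq : mu = sigma lam.
  have H u : 0 * tau (tau u) + a / B * (lam - tau mu) * tau u
             + (tau lam - mu) * u = 0.
    have := psiE (1, 0) (0, u); rewrite psi1 psi2 AE FE CE GE c0 f0 /=.
    rewrite !phiE !rE !rmorphM !rmorph0 !rmorph1 => -[_ e].
    transitivity ((sigma (phi lam) * 1 * u + 0
                   + a / B * (lam * 1 * sigma (phi u) + 0))
      - (mu * u + 0 + a / B * (sigma (phi mu) * sigma (phi u) + 0))).
      by rewrite /=; ring.
    apply/eqP; rewrite subr_eq0; apply/eqP; move: e.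
    by rewrite !(mul0r, mulr0, mul1r, mulr1, addr0, add0r).
  have [_ _ /eqP] := fmorph_powers_independent (tau := tau) tau_theta2 H.
  by rewrite subr_eq0 /= lam_fixed => /eqP.
exists lam => // -[x y].
have -> : (x, y) = (x, 0) + (0, y) by congr pair; rewrite /= ?addr0 ?add0r.
rewrite psiD psi1 psi2 AE FE CE GE c0 f0 !mul0r /twisted_scale mu_eq /=.
by congr pair; rewrite /= ?addr0 ?add0r.
Qed.

(** Some vector (x, 0) satisfies P (x, 0) (1, 0) = P (0, 1) (0, 1), since
    x |-> x + phi x is onto; both products are (2 * B, 0). Applying chi to
    them, the left one is scaled by lam and the right one by sigma lam. *)
Lemma left_scale_sigma_fixed (lam : M) (psi chi : M * M -> M * M) :
    phi lam = lam -> psi =1 twisted_scale lam ->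
    (forall s t, P (psi s) t = chi (P s t)) ->
  sigma lam = lam.
Proof.
move=> lam_fixed psiE chiE.
have add_phi_inj : injective (fun x => x + phi x).
  move=> x y /= e; apply/eqP; rewrite -subr_eq0; apply/eqP/phi_eqN.
  apply/eqP; rewrite -addr_eq0 rmorphB; apply/eqP.
  by transitivity (x + phi x - (y + phi y)); [ring | rewrite e subrr].
have [g _ gK] := injF_bij add_phi_inj.
have [x xE] : exists x, x + phi x = B * (1 + phi 1).
  by exists (g (B * (1 + phi 1))).
have : P (psi (x, 0)) (1, 0) = P (psi (0, 1)) (0, 1).
  rewrite !chiE; congr chi; rewrite /= !phiE !rE !rmorph0 !rmorph1.
  congr pair; last by ring.
  transitivity (x + phi x); first by ring.
  by rewrite xE rmorph1; ring.
have slam_fixed : phi (sigma lam) = sigma lam by rewrite -sigma_phi lam_fixed.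
rewrite !psiE /twisted_scale /= !phiE !rE !rmorphM !rmorph0 !rmorph1.
rewrite lam_fixed slam_fixed => -[e _].
have {e} : B * (1 + 1) * (lam - sigma lam) = 0.
  apply/eqP; rewrite mulrBr subr_eq0; apply/eqP.
  transitivity (lam * (x + phi x)); first by rewrite xE rmorph1; ring.
  apply: etrans (etrans e _); ring.
move/eqP; rewrite !mulf_eq0 (negPf B_neq0) subr_eq0 /= => /orP[/eqP e2|/eqP //].
have /phi_eqN/eqP : phi 1 = -1 :> M.
  by rewrite rmorph1; apply/eqP; rewrite -addr_eq0 e2.
by rewrite oner_eq0.
Qed.

Variables (eps : M * M).
Hypothesis eps0 : eps != 0.

Local Notation circ := (kaplansky P eps).

Lemma familyS_middle_nucleus c :
  c \in middle_nucleus circ <->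
  exists2 lam, phi lam = lam & c = P (twisted_scale lam eps) eps.
Proof.
have nucP := middle_nucleusP familyS_presemifield familyS_mulC eps0.
split=> [/nucP[psi psiE ->]|[lam lamE ->]].
  have [lam lamE psi_lam] := selfadjoint_twisted_scale psiE.
  by exists lam; rewrite ?psi_lam.
apply/nucP; exists (twisted_scale lam) => // s t.
exact: twisted_scale_selfadjoint.
Qed.

Lemma familyS_left_nucleus c :
  c \in left_nucleus circ <->
  exists2 lam, sigma (phi lam) = lam & c = P (twisted_scale lam eps) eps.
Proof.
have nucP := left_nucleusP familyS_presemifield familyS_mulC eps0.
split=> [/nucP[psi [chi psiE ->]]|[lam lamE ->]].
  have [|lam lamE psi_lam] := @selfadjoint_twisted_scale psi.
    by move=> s t; rewrite psiE familyS_mulC -psiE familyS_mulC.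
  exists lam; rewrite ?psi_lam // lamE.
  exact: (left_scale_sigma_fixed lamE psi_lam psiE).
have lam_phi := sigma_phi_fixed lamE.
have lam_sigma : sigma lam = lam by rewrite -{1}lam_phi.
apply/nucP; exists (twisted_scale lam), (twisted_scale lam) => // s t.
exact: twisted_scale_mull.
Qed.

(** The operators [twisted_scale lam] with lam fixed by phi form a field under
    addition and composition, isomorphic to the field of the scalars lam;
    an operator corresponds to its value at eps, multiplied by eps. *)
Lemma familyS_subfield_iso (F : finFieldType) (j : {rmorphism F -> M})
    (N : {set M * M}) :
    (forall y, phi (j y) = j y) ->
    (forall c, c \in N <-> exists2 lam, lam \in codom j
                             & c = P (twisted_scale lam eps) eps) ->
  isomorphic_to_field circ N F.
Proof.
move=> j_fixed NE; have [PDl _ _] := familyS_presemifield.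
exists (fun y => P (twisted_scale (j y) eps) eps); split.
- move=> x y /(presemifield_mulIr familyS_presemifield eps0) [].
  rewrite /twisted_scale => e1 e2; apply/eqP/contraT => xy.
  have jxy : j x - j y != 0 by rewrite subr_eq0 (inj_eq (fmorph_inj j)).
  case/eqP: eps0; case: eps e1 e2 => u v /= e1 e2; congr pair.
    by apply: (mulfI jxy); rewrite mulrBl e1 subrr mulr0.
  have sjxy : sigma (j x - j y) != 0 by rewrite fmorph_eq0.
  by apply: (mulfI sjxy); rewrite rmorphB mulrBl e2 subrr mulr0.
- apply/setP => c; apply/imsetP/idP => [[y _ ->]|].
    by apply/NE; exists (j y); rewrite ?codom_f.
  by case/NE => lam /codomP[y ->] ->; exists y.
- move=> x y; rewrite -PDl; congr P.
  by rewrite /twisted_scale !rmorphD; congr pair; rewrite /= mulrDl.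
- move=> x y; rewrite (kaplanskyC_E familyS_presemifield familyS_mulC eps0).
  rewrite [RHS]twisted_scale_selfadjoint // [RHS]familyS_mulC; congr P.
  by rewrite /twisted_scale !rmorphM /=; congr pair; rewrite mulrA.
Qed.

End FamilyS.

(** * The nuclei of Family S *)

Theorem theorem7p2 (p m k : nat)
    (p_prime : prime p) (p_odd : odd p)
    (m_gt0 : (0 < m)%N) (m_even : ~~ odd m)
    (k_bounds : (1 <= k <= m - 1)%N)
    (mk_odd : odd (m %/ gcdn k m))
    (M L D E : finFieldType)
    (cardM : #|M| = (p ^ m)%N)
    (cardL : #|L| = (p ^ (m %/ 2))%N)
    (cardD : #|D| = (p ^ gcdn (k + m %/ 2) m)%N)
    (cardE : #|E| = (p ^ gcdn k m)%N)
    (iota : {rmorphism L -> M})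
    (B : M) (B_neq0 : B != 0) (B_nonsquare : forall z : M, z ^+ 2 != B)
    (a : L) (a_neq0 : a != 0)
    (eps : M * M) (eps_neq0 : eps != 0) :
  let P := familyS_mul (p ^ k) (p ^ (k + m %/ 2)) B (iota a) in
  let circ := kaplansky P eps in
  [/\ left_nucleus circ = right_nucleus circ,
      isomorphic_to_field circ (left_nucleus circ) D &
      isomorphic_to_field circ (middle_nucleus circ) E].
Proof.
move=> P circ; set h := (m %/ 2)%N in cardL cardD P circ *.
have hm : (h * 2)%N = m by rewrite divnK // dvdn2.
have pM := card_finPcharP cardM p_prime.
have [phi phiE] := frobenius_rmorphism k pM.
have [sigma sigmaE] := frobenius_rmorphism h pM.
have rE x : x ^+ (p ^ (k + h)) = sigma (phi x).
  by rewrite -phiE -sigmaE -exprM -expnD.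
have sigmaK : involutive sigma.
  by move=> x; rewrite -!sigmaE -exprM -expnD addnn -muln2 hm -cardM expf_card.
have odd_pX i : odd (p ^ i) by rewrite oddX p_odd orbT.
have phi_eqN x : phi x = - x -> x = 0.
  by rewrite -phiE; apply: frobenius_eqN p_prime p_odd m_gt0 cardM mk_odd.
have fixed_square x : sigma x = x -> is_square x.
  by rewrite -sigmaE; apply: exp_fixed_is_square p_odd _; rewrite hm.
have B_nsq : ~ is_square B by case=> z Bz; case/eqP: (B_nonsquare z).
have a_fixed : sigma (iota a) = iota a.
  by rewrite -sigmaE -rmorphXn -cardL expf_card.
have ia0 : iota a != 0 by rewrite fmorph_eq0.
have phi_nontrivial : exists theta, phi theta != theta.
  have k_lt_m : (0 < k < m)%N.
    by case/andP: k_bounds => -> /=; rewrite leq_subRL ?add1n.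
  have [theta theta1] := frobenius_nontrivial (prime_gt1 p_prime) k_lt_m cardM.
  by exists theta; rewrite -phiE.
have pmul : presemifield P by apply: familyS_presemifield.
have mulC : commutative P by apply: familyS_mulC.
have [jE jE_fixed] := finField_subfield p_prime cardE cardM (dvdn_gcdr k m).
have [jD jD_fixed] :=
  finField_subfield p_prime cardD cardM (dvdn_gcdr (k + h) m).
have imE x : phi x = x <-> x \in codom jE.
  by rewrite -jE_fixed -(exp_fixed_gcd x k m_gt0 cardM) phiE; split=> /eqP.
have imD x : sigma (phi x) = x <-> x \in codom jD.
  by rewrite -jD_fixed -(exp_fixed_gcd x (k + h) m_gt0 cardM) rE; split=> /eqP.
have iso := familyS_subfield_iso (odd_pX k) (odd_pX (k + h)%N) phiE rE sigmaK
  phi_eqN fixed_square B_nsq a_fixed ia0 eps_neq0.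
have left_nucE := familyS_left_nucleus (odd_pX k) (odd_pX (k + h)%N) phiE rE
  sigmaK phi_eqN fixed_square B_nsq a_fixed ia0 phi_nontrivial eps_neq0.
have middle_nucE := familyS_middle_nucleus (odd_pX k) (odd_pX (k + h)%N) phiE rE
  sigmaK phi_eqN fixed_square B_nsq a_fixed ia0 phi_nontrivial eps_neq0.
split; first exact: left_nucleus_eq_right.
- apply: (iso _ jD) => [y|c].
    by apply: (sigma_phi_fixed phiE) => //; apply/imD/codom_f.
  rewrite left_nucE.
  by split=> -[lam lamE ->]; exists lam => //; apply/imD.
- apply: (iso _ jE) => [y|c]; first exact/imE/codom_f.
  rewrite middle_nucE.
  by split=> -[lam lamE ->]; exists lam => //; apply/imE.
Qed.
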